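(* Let $\mu>0$, let $\mathcal{A}:\mathbb{M}_{n_1,n_2}\to\mathbb{F}^m$ be a linear operator and let $K\ge1$ be an integer. Suppose that $b=\mathcal{A}X_0$ where $X_0\in\mathbb{M}_{n_1,n_2}$ and $\mathrm{rank}(X_0)=K$. Assume that $0<\delta_{2K}^-<1$ and that $$\sigma_K(X_0)>\frac{\sqrt{\mu}}{1-\delta_{2K}^-}.$$ Then $X_0$ is a stationary point of $$\mathcal{R}_{\mu,reg}(X)=\sum_i r_\mu(\sigma_i(X))+\|\mathcal{A}X-b\|_2^2,$$ and it is the unique rank $K$ minimizer, i.e. $$\{X_0\}=\operatorname*{arg\,min}_{\mathrm{rank}(X)\le K}\ \sum_i r_\mu(\sigma_i(X))+\|\mathcal{A}X-b\|_2^2 .$$ Moreover, any other stationary point of $\mathcal{R}_{\mu,reg}$ has rank strictly larger than $K$.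
   Context: $\mathbb{F}$ is $\mathbb{R}$ or $\mathbb{C}$, and $\mathbb{M}_{n_1,n_2}$ is the space of $n_1\times n_2$ matrices with entries in $\mathbb{F}$, equipped with the Frobenius norm $\|\cdot\|_F$. $\sigma_1(X)\ge\sigma_2(X)\ge\dots\ge\sigma_n(X)\ge 0$, $n=\min(n_1,n_2)$, are the singular values of $X$. The function $r_\mu$ is $r_\mu(\sigma)=\mu-\max(\sqrt{\mu}-\sigma,0)^2$ for $\sigma\ge 0$. The lower restricted isometry constant $\delta_{J}^-$ of $\mathcal{A}$ is defined, for an integer $J\ge1$, by $$1-\delta_J^-=\inf\left\{\frac{\|\mathcal{A}X\|_2^2}{\|X\|_F^2}: X\in\mathbb{M}_{n_1,n_2},\ X\ne 0,\ \mathrm{rank}(X)\le J\right\}.$$ A point $X$ is stationary for a functional $g$ if $\liminf_{Y\to X,\,Y\ne X}\frac{g(Y)-g(X)}{\|Y-X\|_F}\ge 0$. *)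

(* Defs.v *)
From HB Require Import structures.
From mathcomp Require Import all_boot all_order all_algebra.
From mathcomp Require Import complex.
From mathcomp Require Import all_classical all_reals all_analysis.

Set Implicit Arguments.
Unset Strict Implicit.
Unset Printing Implicit Defensive.

Import Order.TTheory GRing.Theory Num.Theory.
Import numFieldNormedType.Exports.

Local Open Scope classical_set_scope.
Local Open Scope ring_scope.
Local Open Scope sesquilinear_scope.

Variant scalars := RealScalars | ComplexScalars.

Definition field_of (R : realType) (s : scalars) : numFieldType :=
  match s with
  | RealScalars => R
  | ComplexScalars => R[i]
  end.

Definition to_complex (R : realType) (s : scalars) : field_of R s -> R[i] :=
  match s with
  | RealScalars => fun x => (x +i* 0)%C
  | ComplexScalars => fun z => z
  end.

Section Defs.
Variables (R : realType) (s : scalars).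
Local Notation F := (field_of R s).

(* ComplexField.Normc.normc is the R-valued modulus on R[i]. On column vectors
   this is the Euclidean norm. *)
Definition frobenius m n (X : 'M[F]_(m, n)) : R :=
  Num.sqrt (\sum_i \sum_j ComplexField.Normc.normc (to_complex (X i j)) ^+ 2).

(* The min(m, n) singular values in nonincreasing order: square roots of the
   largest eigenvalues (with multiplicity) of the n x n Gram matrix X^* X,
   whose remaining eigenvalues are 0. A real X is regarded as a complex matrix
   because spectral_diag requires a closed field. *)
Definition singular_values m n (X : 'M[F]_(m, n)) : seq R :=
  let Z := map_mx (@to_complex R s) X in
  let d := spectral_diag (Z ^t* *m Z) in
  take (minn m n) (sort >=%O [seq Num.sqrt (complex.Re (d ord0 i)) | i : 'I_n]).

(* sigma_k, numbered from k = 1. *)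
Definition sigma (k : nat) m n (X : 'M[F]_(m, n)) : R :=
  (singular_values X)`_k.-1.

Definition lower_ric n1 n2 m (A : {linear 'M[F]_(n1, n2) -> 'cV[F]_m})
    (J : nat) : R :=
  1 - inf [set q | exists X : 'M[F]_(n1, n2),
             [/\ X != 0, (\rank X <= J)%N
               & q = frobenius (A X) ^+ 2 / frobenius X ^+ 2]].

Definition r_fun (mu x : R) : R := mu - Num.max (Num.sqrt mu - x) 0 ^+ 2.

Definition R_reg (mu : R) n1 n2 m (A : {linear 'M[F]_(n1, n2) -> 'cV[F]_m})
    (b : 'cV[F]_m) (X : 'M[F]_(n1, n2)) : R :=
  \sum_(x <- singular_values X) r_fun mu x + frobenius (A X - b) ^+ 2.

(* X^' is the punctured neighbourhood filter of the entrywise topology, which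
   is the one induced by the Frobenius norm. *)
Definition stationary n1 n2 (g : 'M[F]_(n1, n2) -> R) (X : 'M[F]_(n1, n2)) :=
  (0 <= limf_einf (fun Y => ((g Y - g X) / frobenius (Y - X))%:E) X^')%E.

End Defs.

Definition argmin (T : Type) (R : realType) (D : set T) (g : T -> R) : set T :=
  [set x | D x /\ forall y, D y -> g x <= g y].

(* Main.v *)
(* Each inequality below compares two matrices through their singular value
   decompositions. It has the form [k Re<f(X), h(Y)> <= sum_i al_i + sum_j be_j] and
   follows from [k f(x_i) h(y_j) <= al_i + be_j] for all i, j, because the overlaps of
   the singular vectors are dominated by a doubly substochastic matrix.
   With [c = sqrt mu / sigma_K(X0) < 1 - delta] the nonzero singular values of X0 are at
   least [sqrt mu / c], and one obtains
   (1) [sum r(sigma(X0)) <= sum r(sigma(X)) + c |X - X0|^2], which gives stationarity of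
       X0 and, since [|A(X - X0)|^2 >= (1 - delta) |X - X0|^2], minimality;
   (2) for a subgradient 2Z at X of the convex function [sum (r(sigma) + sigma^2)],
       [Re<Z - X0, X - X0> >= (1 - c) |X - X0|^2]. Applied at the points of the segment
       from X to X0, it shows that the functional decreases at a positive rate along this
       segment when [rank X <= K] and [X <> X0], so X is not stationary. *)
Require Import Defs.
From HB Require Import structures.
From mathcomp Require Import all_boot all_order all_algebra.
From mathcomp Require Import complex.
From mathcomp Require Import all_classical all_reals all_analysis.
From mathcomp Require Import ring lra.
Import Order.TTheory GRing.Theory Num.Theory.
Import numFieldNormedType.Exports.
Local Open Scope classical_set_scope.
Local Open Scope ring_scope.
Local Open Scope sesquilinear_scope.
Set Implicit Arguments.
Unset Strict Implicit.
Unset Printing Implicit Defensive.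

Notation Re := complex.Re.
Notation Im := complex.Im.

(** * Real inner product and singular value decompositions of complex matrices *)

Section ComplexMatrices.
Variable R : realType.
Implicit Types m n p : nat.
Local Notation C := R[i].
Local Notation sqn z := (Re z ^+ 2 + Im z ^+ 2).

Lemma conjCE (z : C) : z^* = conjc z.
Proof. by []. Qed.

Lemma ReD (z w : C) : Re (z + w) = Re z + Re w.
Proof. by case: z w => [a b] [c d]. Qed.

Lemma ImD (z w : C) : Im (z + w) = Im z + Im w.
Proof. by case: z w => [a b] [c d]. Qed.

Lemma ReN (z : C) : Re (- z) = - Re z.
Proof. by case: z. Qed.

Lemma ImN (z : C) : Im (- z) = - Im z.
Proof. by case: z. Qed.

Lemma ReM (z w : C) : Re (z * w) = Re z * Re w - Im z * Im w.
Proof. by case: z w => [a b] [c d]. Qed.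

Lemma ImM (z w : C) : Im (z * w) = Re z * Im w + Im z * Re w.
Proof. by case: z w => [a b] [c d]. Qed.

Lemma Re_conj (z : C) : Re z^* = Re z.
Proof. by rewrite conjCE; case: z. Qed.

Lemma Im_conj (z : C) : Im z^* = - Im z.
Proof. by rewrite conjCE; case: z. Qed.

Lemma Re_sum (I : finType) (F : I -> C) : Re (\sum_i F i) = \sum_i Re (F i).
Proof. by apply: (big_morph (@complex.Re R)) => // z w; exact: ReD. Qed.

Lemma normc_sq (z : C) : ComplexField.Normc.normc z ^+ 2 = sqn z.
Proof. by case: z => a b; rewrite sqr_sqrtr ?addr_ge0 ?sqr_ge0. Qed.

Lemma trmxC_mul m n p (A : 'M[C]_(m, n)) (B : 'M[C]_(n, p)) :
  (A *m B)^t* = B^t* *m A^t*.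
Proof. by rewrite trmx_mul map_mxM. Qed.

Lemma trmxC_sub m n (A B : 'M[C]_(m, n)) : (A - B)^t* = A^t* - B^t*.
Proof. by apply/matrixP => i j; rewrite !mxE rmorphB. Qed.

Lemma trmxC_diag n (d : 'I_n -> R) :
  (diag_mx (\row_i (d i)%:C%C))^t* = diag_mx (\row_i (d i)%:C%C).
Proof.
apply/matrixP=> i j; rewrite !mxE eq_sym.
by case: eqVneq => [->|_]; rewrite ?mulr1n ?mulr0n ?conjC0 // conjCE conjc_real.
Qed.

(* The real inner product for which [frobenius] is the Euclidean norm. *)
Definition rdot m n (Z W : 'M[C]_(m, n)) : R :=
  \sum_i \sum_j (Re (Z i j) * Re (W i j) + Im (Z i j) * Im (W i j)).

Lemma rdotC m n (Z W : 'M[C]_(m, n)) : rdot Z W = rdot W Z.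
Proof.
by apply: eq_bigr => i _; apply: eq_bigr => j _; rewrite mulrC [X in _ + X]mulrC.
Qed.

Lemma rdotDr m n (Z W V : 'M[C]_(m, n)) : rdot Z (W + V) = rdot Z W + rdot Z V.
Proof.
rewrite -big_split; apply: eq_bigr => i _; rewrite -big_split.
by apply: eq_bigr => j _ /=; rewrite !mxE ReD ImD; ring.
Qed.

Lemma rdotNr m n (Z W : 'M[C]_(m, n)) : rdot Z (- W) = - rdot Z W.
Proof.
rewrite -sumrN; apply: eq_bigr => i _; rewrite -sumrN.
by apply: eq_bigr => j _ /=; rewrite !mxE ReN ImN; ring.
Qed.

Lemma rdotZr m n a (Z W : 'M[C]_(m, n)) : rdot Z (a%:C%C *: W) = a * rdot Z W.
Proof.
rewrite /rdot mulr_sumr; apply: eq_bigr => i _; rewrite mulr_sumr.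
by apply: eq_bigr => j _ /=; rewrite !mxE ReM ImM /=; ring.
Qed.

Lemma rdotDl m n (Z W V : 'M[C]_(m, n)) : rdot (Z + W) V = rdot Z V + rdot W V.
Proof. by rewrite rdotC rdotDr !(rdotC V). Qed.

Lemma rdotNl m n (Z W : 'M[C]_(m, n)) : rdot (- Z) W = - rdot Z W.
Proof. by rewrite rdotC rdotNr rdotC. Qed.

Lemma rdotZl m n a (Z W : 'M[C]_(m, n)) : rdot (a%:C%C *: Z) W = a * rdot Z W.
Proof. by rewrite rdotC rdotZr rdotC. Qed.

Definition rdotE := (rdotDr, rdotDl, rdotNr, rdotNl, rdotZr, rdotZl).

Lemma rdotBB m n (Z W V : 'M[C]_(m, n)) :
  rdot (Z - V) (W - V) = rdot Z W - rdot Z V - (rdot W V - rdot V V).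
Proof. by rewrite !rdotE (rdotC V W); ring. Qed.

Lemma rdotB_self m n (Z W : 'M[C]_(m, n)) :
  rdot (Z - W) (Z - W) = rdot Z Z + rdot W W - 2 * rdot Z W.
Proof. by rewrite rdotBB; ring. Qed.

Lemma rdot_ge0 m n (Z : 'M[C]_(m, n)) : 0 <= rdot Z Z.
Proof.
by apply: sumr_ge0 => i _; apply: sumr_ge0 => j _; rewrite -!expr2 addr_ge0 ?sqr_ge0.
Qed.

Lemma rdot_mxtrace m n (Z W : 'M[C]_(m, n)) : rdot Z W = Re (\tr (Z^t* *m W)).
Proof.
rewrite Re_sum /rdot exchange_big; apply: eq_bigr => i _ /=; rewrite mxE Re_sum.
by apply: eq_bigr => j _; rewrite !mxE ReM Re_conj Im_conj; ring.
Qed.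

(* Doubly substochastic weights: the vector-case inequality summed against the
   weights gives the matrix case. *)
Lemma substochastic_sum_le n1 n2 (b : 'I_n1 -> 'I_n2 -> R) f h
    (al : 'I_n1 -> R) (be : 'I_n2 -> R) :
  (forall i j, 0 <= b i j) ->
  (forall i, \sum_j b i j <= 1) -> (forall j, \sum_i b i j <= 1) ->
  (forall i, 0 <= al i) -> (forall j, 0 <= be j) ->
  (forall i j, f i * h j <= al i + be j) ->
  \sum_i \sum_j f i * h j * b i j <= \sum_i al i + \sum_j be j.
Proof.
move=> b0 br bc al0 be0 fh.
apply: (@le_trans _ _ (\sum_i \sum_j (al i * b i j + be j * b i j))).
  by do 2![apply: ler_sum => ? _]; rewrite -mulrDl ler_wpM2r.
under eq_bigr do rewrite big_split.
rewrite big_split /= lerD //.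
  by apply: ler_sum => i _; rewrite -mulr_sumr ler_piMr.
by rewrite exchange_big; apply: ler_sum => j _; rewrite -mulr_sumr ler_piMr.
Qed.

(* [U^* U] is a 0/1 diagonal matrix when the columns of U are orthonormal or 0. *)
Lemma bessel m n (U : 'M[C]_(m, n)) (e : 'I_n -> bool) p (V : 'M[C]_(m, p)) k :
  U^t* *m U = diag_mx (\row_i ((e i)%:R : R)%:C%C) ->
  (forall i j, ~~ e i -> U j i = 0) ->
  \sum_i sqn ((U^t* *m V) i k) <= Re ((V^t* *m V) k k).
Proof.
move=> UU U0.
have UE : U *m diag_mx (\row_i ((e i)%:R : R)%:C%C) = U.
  rewrite mul_mx_diag; apply/matrixP => i j; rewrite !mxE.
  by case: (boolP (e j)) => [_|/U0 ->]; rewrite ?mulr1 ?mul0r.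
set M := U^t* *m V.
have MM : Re ((M^t* *m M) k k) = \sum_i sqn (M i k).
  rewrite !mxE Re_sum; apply: eq_bigr => i _.
  by rewrite !mxE ReM Re_conj Im_conj; ring.
(* [r] is the residual of the orthogonal projection of [V] onto the columns of [U]. Its Gram matrix
   is that of [V] minus that of [M], and a Gram matrix has a nonnegative diagonal. *)
set r := V - U *m M.
have : 0 <= Re ((r^t* *m r) k k).
  rewrite !mxE Re_sum; apply: sumr_ge0 => i _.
  rewrite [r^t* k i]mxE [r^T k i]mxE ReM Re_conj Im_conj mulNr opprK -!expr2.
  by rewrite addr_ge0 ?sqr_ge0.
have -> : r^t* *m r = V^t* *m V - M^t* *m M.
  rewrite /r trmxC_sub trmxC_mul mulmxBl !mulmxBr.
  have -> : V^t* *m (U *m M) = M^t* *m M.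
    by rewrite [M^t*]trmxC_mul trmxCK mulmxA.
  have -> : M^t* *m U^t* *m V = M^t* *m M by rewrite -mulmxA.
  have -> : M^t* *m U^t* *m (U *m M) = M^t* *m M.
    rewrite -!mulmxA; congr (_ *m _); rewrite mulmxA UU /M mulmxA.
    by rewrite -[in RHS]UE trmxC_mul trmxC_diag.
  by rewrite subrr subr0.
by rewrite mxE [X in _ + X]mxE ReD ReN MM subr_ge0.
Qed.

(* An economy-size singular value decomposition U diag(x) P; the columns of U
   with x i = 0 are set to 0 instead of being completed to an orthonormal
   family. *)
Definition is_svd m n (Z : 'M[C]_(m, n)) (U : 'M[C]_(m, n)) (x : 'I_n -> R)
    (P : 'M[C]_n) : Prop :=
  [/\ Z = U *m diag_mx (\row_i (x i)%:C%C) *m P,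
      P \is unitarymx,
      U^t* *m U = diag_mx (\row_i ((x i != 0)%:R : R)%:C%C),
      forall i j, ~~ (x i != 0) -> U j i = 0
    & forall i, 0 <= x i].

(** Under [is_svd] the columns of [U] with [x i = 0] vanish, so the matrix is the same as if
    [f 0 = 0]. With [f = Num.max tau] it will be half a subgradient. *)
Definition spectral_fun m n (U : 'M[C]_(m, n)) (x : 'I_n -> R) (P : 'M[C]_n)
    (f : R -> R) := U *m diag_mx (\row_i (f (x i))%:C%C) *m P.

Lemma spectral_fun_addZ m n (U : 'M[C]_(m, n)) x (P : 'M[C]_n) f g a :
  spectral_fun U x P (fun y => f y + a * g y) =
  spectral_fun U x P f + a%:C%C *: spectral_fun U x P g.
Proof.
rewrite /spectral_fun scalemxAl -mulmxDl; congr (_ *m P).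
apply/matrixP => i j; rewrite !mul_mx_diag !mxE rmorphD rmorphM /=.
by rewrite mulrDr mulrCA.
Qed.

(** Cyclicity of the trace separates the overlaps of the left singular vectors from those of the
    right ones. *)
Lemma rdot_spectral_fun m n (U U' : 'M[C]_(m, n)) x x' (P P' : 'M[C]_n) f h :
  rdot (spectral_fun U x P f) (spectral_fun U' x' P' h) =
  \sum_i \sum_j f (x i) * h (x' j) *
     Re ((U^t* *m U') i j * (P' *m P^t*) j i).
Proof.
rewrite rdot_mxtrace /spectral_fun !trmxC_mul trmxC_diag.
rewrite -!mulmxA mxtrace_mulC -!mulmxA (mulmxA (U^t*)).
rewrite Re_sum; apply: eq_bigr => i _.
rewrite mul_diag_mx mxE [X in _ * X]mxE mulr_sumr Re_sum.
apply: eq_bigr => j _; rewrite mul_diag_mx [(\matrix_(_, _) _) j i]mxE.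
move: ((U^t* *m U') i j) ((P' *m P^t*) j i) => u v.
by rewrite !mxE !ReM !ImM /=; ring.
Qed.

(** Orthonormality leaves only the diagonal overlaps; the 0/1 factor comes from the zero columns of
    [U]. *)
Lemma rdot_spectral_fun_same m n (Z U : 'M[C]_(m, n)) x P f h :
  is_svd Z U x P ->
  rdot (spectral_fun U x P f) (spectral_fun U x P h) =
  \sum_i (x i != 0)%:R * (f (x i) * h (x i)).
Proof.
move=> [_ /unitarymxP PP UU _ _]; rewrite rdot_spectral_fun UU PP.
apply: eq_bigr => i _; rewrite (bigD1 i) //= big1 => [|j ji].
  by rewrite !mxE !eqxx ReM /=; ring.
by rewrite [(diag_mx _) i j]mxE eq_sym (negbTE ji) mulr0n mul0r mulr0.
Qed.

(* A substitute for von Neumann's trace inequality: the inner product of the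
   left and right singular vectors is bounded by AM-GM, which gives doubly
   substochastic weights by Bessel's inequality. *)
Lemma rdot_spectral_fun_le m n (Z U Z' U' : 'M[C]_(m, n)) x x' P P' f h al be k :
  0 < k ->
  is_svd Z U x P -> is_svd Z' U' x' P' ->
  (forall i, 0 <= al i) -> (forall j, 0 <= be j) ->
  (forall i, 0 <= f (x i)) -> (forall j, 0 <= h (x' j)) ->
  (forall i j, k * (f (x i) * h (x' j)) <= al i + be j) ->
  k * rdot (spectral_fun U x P f) (spectral_fun U' x' P' h) <=
  \sum_i al i + \sum_j be j.
Proof.
move=> k0 [_ Pu UU U0 _] [_ P'u UU' U0' _] al0 be0 f0 h0 fh.
rewrite rdot_spectral_fun.
set M := U^t* *m U'; set N := P' *m P^t*.
pose b i j := (sqn (M i j) + sqn (N j i)) / 2.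
apply: (@le_trans _ _ (\sum_i \sum_j (k * f (x i)) * h (x' j) * b i j)).
  rewrite mulr_sumr; apply: ler_sum => i _; rewrite mulr_sumr.
  apply: ler_sum => j _; rewrite mulrA [k * (_ * _)]mulrA; apply: ler_wpM2l.
    by rewrite !mulr_ge0 // ltW.
  rewrite ReM /b.
  have := sqr_ge0 (Re (M i j) - Re (N j i)).
  have := sqr_ge0 (Im (M i j) + Im (N j i)).
  by lra.
have sq_conj (z : C) : sqn (z^*) = sqn z by rewrite Re_conj Im_conj sqrrN.
have half_le (I : finType) (F G : I -> R) : \sum_i F i <= 1 -> \sum_i G i <= 1 ->
    \sum_i (F i + G i) / 2 <= 1.
  by rewrite -mulr_suml big_split /=; lra.
have norm1 (V : 'M[C]_(m, n)) (e : 'I_n -> bool) l :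
    V^t* *m V = diag_mx (\row_i ((e i)%:R : R)%:C%C) -> Re ((V^t* *m V) l l) <= 1.
  by move=> ->; rewrite !mxE eqxx mulr1n; case: (e l); rewrite /= ?ler01.
have unit_row (Q : 'M[C]_n) l : Q \is unitarymx -> \sum_i sqn (Q l i) <= 1.
  move=> /unitarymxP /(congr1 (fun T : 'M[C]_n => Re (T l l))).
  rewrite !mxE eqxx Re_sum /= => <-; apply: ler_sum => i _.
  by rewrite !mxE ReM Re_conj Im_conj mulrN opprK -!expr2.
have Nu : N \is unitarymx.
  have := Pu; rewrite -(trmxC_unitary P) => Pu'.
  exact: mul_unitarymx P'u Pu'.
apply: (@substochastic_sum_le _ _ b (fun i => k * f (x i)) (fun j => h (x' j)))
  => // [i j|i|j|i j]; last by rewrite -mulrA.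
- by rewrite /b mulr_ge0 ?addr_ge0 ?sqr_ge0.
- apply: half_le.
    (* Row sums for [M] are column sums for its adjoint, so Bessel's inequality applies with [U] and
       [U'] exchanged. *)
    have -> : \sum_j sqn (M i j) = \sum_j sqn ((U'^t* *m U) j i).
      apply: eq_bigr => j _; rewrite -(sq_conj (M i j)).
      have -> : U'^t* *m U = M^t* by rewrite /M trmxC_mul trmxCK.
      by rewrite [(M^t*) j i]mxE [M^T j i]mxE.
    by apply: le_trans (bessel U i UU' U0') (norm1 _ _ _ UU).
  have -> : \sum_j sqn (N j i) = \sum_j sqn (N^t* i j).
    by apply: eq_bigr => j _; rewrite [N^t* i j]mxE [N^T i j]mxE sq_conj.
  by apply: unit_row; rewrite trmxC_unitary.
- apply: half_le; last exact: unit_row.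
  exact: le_trans (bessel U' j UU U0) (norm1 _ _ _ UU').
Qed.

End ComplexMatrices.

(** * Counting nonzero entries *)

(** If entry [i] were nonzero, the [i.+1] entries up to it would all be positive, too many for the
    count. *)
Lemma nth_sorted_count_eq0 (R : realType) (l : seq R) k i :
  sorted >=%O l -> all (>= 0) l -> (count (predC1 0%R) l <= k)%N -> (k <= i)%N ->
  l`_i = 0.
Proof.
move=> sl /allP l0 ck ki; apply/eqP; apply: contraLR ck => li; rewrite -ltnNge.
have il : (i < size l)%N by rewrite ltnNge; apply: contra li => /(nth_default 0) ->.
apply: leq_trans (_ : (i < _)%N); first by rewrite ltnS.
rewrite -(cat_take_drop i.+1 l) count_cat; apply: leq_trans (leq_addr _ _).
suff : all (predC1 0) (take i.+1 l).
  by rewrite all_count => /eqP ->; rewrite size_takel.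
have ge_trans : transitive (>=%O : rel R) by move=> a b c ab bc; exact: le_trans bc ab.
apply/(all_nthP 0) => j; rewrite size_takel // ltnS => ji; rewrite nth_take //=.
have := @sorted_leq_nth _ _ ge_trans lexx 0 l sl j i.
rewrite !inE => /(_ (leq_ltn_trans ji il) il ji) /= lij.
by rewrite gt_eqF // (lt_le_trans _ lij) // lt_neqAle eq_sym li l0 ?mem_nth.
Qed.

(** The nonzero diagonal entries form an invertible submatrix, cut out by multiplying with selection
    matrices on both sides. *)
Lemma card_neq0_le_rank_diag (F : fieldType) n (d : 'rV[F]_n) :
  (#|[pred i | d ord0 i != 0%R]| <= \rank (diag_mx d))%N.
Proof.
set S := [pred i | d ord0 i != 0%R]; pose f (i : 'I_#|S|) := enum_val i.
have fS i : d ord0 (f i) != 0 by have := enum_valP i; rewrite inE.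
pose e := \row_i (d ord0 (f i)).
have -> : #|S| = \rank (diag_mx e).
  by rewrite mxrank_unit // unitmxE det_diag unitfE prodf_seq_neq0; apply/allP => i _;
    rewrite mxE fS.
have -> : diag_mx e = rowsub f 1%:M *m diag_mx d *m colsub f 1%:M.
  apply/matrixP => i j; rewrite -mulmxA mul_diag_mx !mxE (bigD1 (f i)) //= big1 => [|k].
    by rewrite !mxE eqxx mul1r addr0 (inj_eq enum_val_inj); case: eqP => [->|];
      rewrite ?mulr1n ?mulr1 ?mulr0n ?mulr0.
  by rewrite !mxE eq_sym => /negbTE ->; rewrite mul0r.
by apply: leq_trans (mxrankM_maxl _ _) (mxrankM_maxr _ _).
Qed.

(** * The two scalar fields inside the complex numbers *)

Section Scalars.
Variables (R : realType) (s : scalars).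
Local Notation F := (field_of R s).
Local Notation C := R[i].
Local Notation tc := (@to_complex R s).

Fact to_complex_additive : additive tc.
Proof. by case: s => x y //=; rewrite -[RHS]/(_ +i* _)%C subr0. Qed.
HB.instance Definition _ := GRing.isAdditive.Build F C tc to_complex_additive.

Fact to_complex_multiplicative : multiplicative tc.
Proof.
case: s; split=> // x y /=.
by rewrite -[RHS]/(_ +i* _)%C !mulr0 mul0r subr0 addr0.
Qed.
HB.instance Definition _ :=
  GRing.isMultiplicative.Build F C tc to_complex_multiplicative.

Definition of_real : R -> F :=
  match s with RealScalars => id | ComplexScalars => fun x => (x%:C)%C end.

Lemma to_complex_of_real a : tc (of_real a) = (a%:C)%C.
Proof. by rewrite /of_real; case: s. Qed.

Lemma norm_of_real (x : F) : `|x| = of_real (ComplexField.Normc.normc (tc x)).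
Proof. by rewrite /of_real; case: s x => x //=; rewrite expr0n /= addr0 sqrtr_sqr. Qed.

Lemma ltr_of_real a b : (of_real a < of_real b) = (a < b).
Proof. by rewrite /of_real; case: s => //; exact: ltcR. Qed.

(** The partial order of [R[i]] forces a positive element to be real, so radii of balls over either
    field are real numbers. *)
Lemma of_real_gt0 (e : F) : 0 < e -> exists2 r, 0 < r & e = of_real r.
Proof.
rewrite /of_real; case: s e => e /= e0; first by exists e.
by case: e e0 => a b; rewrite ltcE /= => /andP[/eqP-> a0]; exists a.
Qed.

Definition cplx m n (X : 'M[F]_(m, n)) : 'M[C]_(m, n) := map_mx tc X.

Lemma cplxB m n (X Y : 'M[F]_(m, n)) : cplx (X - Y) = cplx X - cplx Y.
Proof. exact: map_mxB. Qed.

Lemma cplxD m n (X Y : 'M[F]_(m, n)) : cplx (X + Y) = cplx X + cplx Y.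
Proof. exact: map_mxD. Qed.

Lemma cplxZ m n a (X : 'M[F]_(m, n)) : cplx (of_real a *: X) = (a%:C)%C *: cplx X.
Proof. by rewrite /cplx map_mxZ /= to_complex_of_real. Qed.

Lemma frobenius_sq m n (X : 'M[F]_(m, n)) :
  frobenius X ^+ 2 = rdot (cplx X) (cplx X).
Proof.
rewrite sqr_sqrtr; last by do 2![apply: sumr_ge0 => ? _]; exact: sqr_ge0.
by do 2![apply: eq_bigr => ? _]; rewrite normc_sq !mxE -!expr2.
Qed.

Lemma frobenius_ge0 m n (X : 'M[F]_(m, n)) : 0 <= frobenius X.
Proof. exact: sqrtr_ge0. Qed.

Lemma frobenius_eq0 m n (X : 'M[F]_(m, n)) : frobenius X = 0 -> X = 0.
Proof.
move=> X0; have /eqP : rdot (cplx X) (cplx X) = 0.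
  by rewrite -frobenius_sq X0 expr0n /=.
have ge0 (z : C) : 0 <= Re z * Re z + Im z * Im z.
  by apply: addr_ge0; rewrite -expr2 sqr_ge0.
rewrite psumr_eq0 => [|i _]; last exact: sumr_ge0.
move=> /allP sum0; apply/matrixP => i j; rewrite mxE.
move/(_ i (mem_index_enum _)): sum0; rewrite /= psumr_eq0 //.
move=> /allP /(_ j (mem_index_enum _)); rewrite /= -!expr2 -normc_sq sqrf_eq0.
by move=> /eqP /ComplexField.Normc.eq0_normc /eqP; rewrite mxE fmorph_eq0 => /eqP.
Qed.

(** * Existence of the decomposition, and its link with the sorted singular values *)

Section Svd.
Variables (m n : nat) (X : 'M[F]_(m, n)).
Let Z := cplx X.
Let G := Z^t* *m Z.

(** The numbers of [singular_values] before sorting and truncation, indexed like the rows of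
    [spectralmx G], that is, like the right singular vectors. *)
Definition gram_sqrt (i : 'I_n) : R := Num.sqrt (Re (spectral_diag G ord0 i)).

Lemma gram_diag : (Z *m (spectralmx G)^t*)^t* *m (Z *m (spectralmx G)^t*) =
  diag_mx (spectral_diag G).
Proof.
have Gn : G \is normalmx.
  by apply/normalmxP; have -> : G^t* = G by rewrite /G trmxC_mul trmxCK.
have Pu := spectral_unitarymx G.
rewrite trmxC_mul trmxCK mulmxA -(mulmxA _ _ Z) -/G {2}(orthomx_spectralP Gn).
rewrite invmx_unitary // -!mulmxA (unitarymxP Pu) mulmx1 mulmxA.
by rewrite (unitarymxP Pu) mul1mx.
Qed.

(** By [gram_diag] each eigenvalue is the squared norm of a column of [B], hence real and
    nonnegative, and it vanishes only if the column does. *)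
Lemma spectral_diag_gram i :
  spectral_diag G ord0 i = ((gram_sqrt i ^+ 2)%:C)%C /\
  forall j, gram_sqrt i = 0 -> (Z *m (spectralmx G)^t*) j i = 0.
Proof.
set B := Z *m (spectralmx G)^t*.
have di : spectral_diag G ord0 i =
    ((\sum_j (Re (B j i) ^+ 2 + Im (B j i) ^+ 2))%:C)%C.
  have -> : spectral_diag G ord0 i = (B^t* *m B) i i.
    by rewrite gram_diag mxE eqxx mulr1n.
  rewrite mxE rmorph_sum; apply: eq_bigr => j _.
  rewrite [B^t* i j]mxE [B^T i j]mxE conjCE; case: (B j i) => a b /=.
  by rewrite -[LHS]/(_ +i* _)%C; congr (_ +i* _)%C; ring.
have d0 : 0 <= \sum_j (Re (B j i) ^+ 2 + Im (B j i) ^+ 2).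
  by apply: sumr_ge0 => j _; rewrite addr_ge0 ?sqr_ge0.
split=> [|j]; first by rewrite /gram_sqrt di sqr_sqrtr.
rewrite /gram_sqrt di /= => /eqP; rewrite sqrtr_eq0 => dle0.
have /eqP := le_anti (introT andP (conj dle0 d0)).
rewrite psumr_eq0 => [/allP /(_ j (mem_index_enum _))|k _] /=; last first.
  by rewrite addr_ge0 ?sqr_ge0.
rewrite paddr_eq0 ?sqr_ge0 // !sqrf_eq0; case: (B j i) => a b /=.
by case/andP => /eqP -> /eqP ->.
Qed.

Lemma svd_exists : exists U P, is_svd Z U gram_sqrt P.
Proof.
set B := Z *m (spectralmx G)^t*.
have Pu := spectral_unitarymx G.
(* The columns of [B] are normalised; since [0^-1 = 0], those with singular value 0 become 0, as
   [is_svd] demands. *)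
pose U := B *m diag_mx (\row_i (((gram_sqrt i)^-1)%:C)%C).
exists U, (spectralmx G); split => //.
- rewrite /U -(mulmxA B) mulmx_diag.
  suff -> : B *m diag_mx (\row_j ((\row_i ((gram_sqrt i)^-1)%:C%C) ord0 j *
      (\row_i (gram_sqrt i)%:C%C) ord0 j)) = B.
    by rewrite mulmxKtV.
  rewrite mul_mx_diag; apply/matrixP => i j; rewrite !mxE -rmorphM /=.
  have [xj|xj] := eqVneq (gram_sqrt j) 0; last by rewrite mulVf ?mulr1.
  by rewrite -[\sum_k _]/(\sum_k Z i k * (spectralmx G)^t* k j);
    have := (spectral_diag_gram j).2 i xj; rewrite mxE => ->; rewrite mul0r.
- have gB : B^t* *m B = diag_mx (spectral_diag G) by exact: gram_diag.
  rewrite /U trmxC_mul trmxC_diag -mulmxA (mulmxA (B^t*)) gB.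
  rewrite !mulmx_diag; congr diag_mx; apply/rowP => i; rewrite !mxE.
  rewrite (spectral_diag_gram i).1 -!rmorphM; congr (_%:C)%C.
  have [->|xi] := eqVneq (gram_sqrt i) 0; first by rewrite invr0 mul0r.
  by rewrite expr2 mulrA mulrA mulVf // mul1r divff.
- move=> i j /negPn /eqP xi.
  by rewrite /U mul_mx_diag mxE (spectral_diag_gram i).2 ?mul0r.
- by move=> i; exact: sqrtr_ge0.
Qed.

Let sorted_values := sort >=%O [seq gram_sqrt i | i : 'I_n].

Let sorted_values_ge0 : all (>= 0) sorted_values.
Proof.
by rewrite all_sort; apply/allP => _ /mapP[i _ ->]; exact: sqrtr_ge0.
Qed.

Let sorted_values_sorted : sorted >=%O sorted_values.
Proof. by apply: sort_sorted => a b; exact: le_total. Qed.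

(** By [gram_diag] the diagonal matrix of eigenvalues is a product containing [Z] as a factor, so
    its rank is at most that of [Z]. *)
Lemma count_gram_sqrt k : (\rank X <= k)%N -> (count (predC1 0%R) sorted_values <= k)%N.
Proof.
move=> Xk; apply: leq_trans Xk.
have -> : \rank X = \rank Z by rewrite mxrank_map.
have rd : (\rank (diag_mx (spectral_diag G)) <= \rank Z)%N.
  by rewrite -gram_diag; apply: leq_trans (mxrankM_maxr _ _) (mxrankM_maxl _ _).
apply: leq_trans rd; apply: leq_trans (card_neq0_le_rank_diag _).
rewrite (permP (permEl (perm_sort _ _))) count_map -size_filter cardE.
rewrite enumT /enum_mem; apply/eq_leq; congr size; apply: eq_filter => i.
by rewrite !inE /= (spectral_diag_gram i).1 -(inj_eq (@complexI R)) rmorphXn /= sqrf_eq0.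
Qed.

(** At most [minn m n] values are nonzero, so truncating the sorted list discards only zeros, where
    [f] vanishes. *)
Lemma sum_singular_values (f : R -> R) : f 0 = 0 ->
  \sum_(x <- singular_values X) f x = \sum_i f (gram_sqrt i).
Proof.
move=> f0; rewrite -[singular_values X]/(take (minn m n) sorted_values).
have -> : \sum_i f (gram_sqrt i) = \sum_(x <- sorted_values) f x.
  rewrite (perm_big _ (permEl (perm_sort _ _))) big_map.
  by rewrite big_enum.
rewrite -[in RHS](cat_take_drop (minn m n) sorted_values) big_cat /=.
rewrite [X in _ + X]big1_seq ?addr0 // => x /= /(nthP 0) [i _ <-].
rewrite nth_drop (@nth_sorted_count_eq0 _ _ (minn m n)) ?leq_addr //.
by apply: count_gram_sqrt; rewrite leq_min rank_leq_row rank_leq_col.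
Qed.

(** A nonzero value sits at one of the first [k] positions of the sorted list, hence is at least the
    [k]-th one. *)
Lemma gram_sqrt_gap k i :
  (\rank X <= k)%N -> gram_sqrt i = 0 \/ sigma k X <= gram_sqrt i.
Proof.
move=> Xk; have [->|xi] := eqVneq (gram_sqrt i) 0; [by left|right].
rewrite /sigma -[singular_values X]/(take (minn m n) sorted_values).
have : gram_sqrt i \in sorted_values.
  by rewrite mem_sort; apply/mapP; exists i; rewrite ?mem_enum.
case/(nthP 0) => j jl xj; rewrite -xj.
have jk : (j < k)%N.
  rewrite ltnNge; apply: contra xi => kj; rewrite -xj.
  by rewrite (nth_sorted_count_eq0 _ _ (count_gram_sqrt Xk)).
case: k jk Xk => // k; rewrite ltnS => jk Xk /=.
have ge_trans : transitive (>=%O : rel R) by move=> a b c ab bc; exact: le_trans bc ab.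
(* Beyond the end of the truncated list [sigma] is the default value 0, below every entry. *)
have [kd|dk] := ltnP k (minn m n); last first.
  rewrite nth_default ?(allP sorted_values_ge0) ?mem_nth //.
  by rewrite (leq_trans _ dk) // size_take_min geq_minl.
rewrite nth_take //.
have [kl|lk] := ltnP k (size sorted_values); last first.
  by rewrite nth_default // (allP sorted_values_ge0) ?mem_nth.
exact: (@sorted_leq_nth _ _ ge_trans lexx 0 _ sorted_values_sorted j k jl kl jk).
Qed.

End Svd.
End Scalars.

(** * Inequalities between two single singular values *)

Section ScalarInequalities.
Variables (R : realType) (mu : R).
Implicit Types c x y : R.
Hypothesis mu_gt0 : 0 < mu.
Local Notation tau := (Num.sqrt mu).
Local Notation r := (r_fun mu).

Let tau_gt0 : 0 < tau. Proof. by rewrite sqrtr_gt0. Qed.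
Let mu_sqr : mu = tau * tau. Proof. by rewrite -expr2 sqr_sqrtr // ltW. Qed.

Lemma r_funE x : r x = if x <= tau then 2 * tau * x - x * x else tau * tau.
Proof.
rewrite /r_fun [X in X - _]mu_sqr; case: (leP x tau) => xt.
  by rewrite max_l ?subr_ge0 //; ring.
by rewrite max_r ?subr_le0 1?ltW // expr0n /= subr0.
Qed.

Lemma r_fun0 : r 0 = 0.
Proof. by rewrite r_funE ltW // mulr0 mul0r subr0. Qed.

Lemma r_fun_ge0 x : 0 <= x -> 0 <= r x.
Proof.
move=> x0; rewrite r_funE; case: (leP x tau) => xt; last by rewrite mulr_ge0 ?ltW.
rewrite -mulrBl mulr_ge0 //; have := tau_gt0; lra.
Qed.

Lemma r_fun_le x : r x <= tau * tau.
Proof.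
by rewrite r_funE; case: (leP x tau) => xt //; have := sqr_ge0 (x - tau); nra.
Qed.

(** For [x <= tau <= c * y] the loss [tau ^+ 2 - r x] is [(tau - x) ^+ 2]. Both
    [tau - x <= c * (y - x)] and [tau <= y] hold because [c <= 1], which bounds it by
    [c * (y - x) ^+ 2]. *)
Lemma r_fun_growth c x y : 0 < c -> c <= 1 -> 0 <= x ->
  y = 0 \/ tau <= c * y -> r y <= r x + c * (x - y) ^+ 2.
Proof.
move=> c0 c1 x0 [->|y_large].
  by rewrite r_fun0 addr_ge0 ?r_fun_ge0 // mulr_ge0 ?sqr_ge0 // ltW.
apply: le_trans (r_fun_le y) _.
rewrite r_funE; case: (leP x tau) => xt; last by have := sqr_ge0 (x - y); nra.
have h1 : tau - x <= c * (y - x) by nra.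
have h2 : 0 <= y - x by nra.
have h3 : (tau - x) ^+ 2 <= (c * (y - x)) * (tau - x).
  by rewrite expr2 ler_wpM2r // subr_ge0.
have h4 : c * (y - x) * (tau - x) <= c * (y - x) * (y - x).
  by apply: ler_wpM2l; nra.
nra.
Qed.

(** [r x + x ^+ 2] is [2 * tau * x] up to [tau] and [tau ^+ 2 + x ^+ 2] beyond: convex on the
    half-line, and [2 * Num.max tau y] is a slope of support at [y]. *)
Lemma r_fun_subgrad x y : 0 <= x -> 0 <= y ->
  2 * Num.max tau y * (x - y) <= (r x + x * x) - (r y + y * y).
Proof.
move=> x0 y0; rewrite !r_funE.
have := (sqr_ge0 (x - tau), sqr_ge0 (x - y), sqr_ge0 (y - tau)).
case: (leP y tau) => yt; case: (leP x tau) => xt [[sq1 sq2] sq3]; nra.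
Qed.

(** The gap matters only for [x < tau]: if [y] is nonzero, then [y - tau >= (1 - c) * y >= (1 - c) *
    (y - x)]. *)
Lemma subgrad_monotone c x y : 0 < c -> c <= 1 -> 0 <= x ->
  y = 0 \/ tau <= c * y ->
  (1 - c) * (x - y) ^+ 2 <= (Num.max tau x - y) * (x - y).
Proof.
move=> c0 c1 x0 hy; have := tau_gt0; case: (leP tau x) => xt t0.
  by have := sqr_ge0 (x - y); nra.
case: hy => [->|y_large]; first by rewrite !subr0; nra.
have yx : x <= y by nra.
have : (1 - c) * (y - x) <= y - tau by nra.
nra.
Qed.

End ScalarInequalities.

(** * From scalar inequalities to matrices *)

Section Comparison.
Variables (R : realType) (s : scalars) (m n : nat) (mu : R).
Local Notation F := (field_of R s).
Local Notation tau := (Num.sqrt mu).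
Local Notation r := (r_fun mu).
Implicit Types X Y : 'M[F]_(m, n).

Definition penalty X : R := \sum_(x <- singular_values X) r x.

Hypothesis mu_gt0 : 0 < mu.
Let tau_ge0 : 0 <= tau. Proof. exact: sqrtr_ge0. Qed.

Let penaltyE X : penalty X = \sum_i r (gram_sqrt X i).
Proof. exact/sum_singular_values/r_fun0. Qed.

Lemma spectral_fun_id X U P :
  is_svd (cplx X) U (gram_sqrt X) P -> cplx X = spectral_fun U (gram_sqrt X) P id.
Proof. by case. Qed.

Lemma sum_mask_neq0 X (f : 'I_n -> R) :
  (forall i, gram_sqrt X i = 0 -> f i = 0) ->
  \sum_i (gram_sqrt X i != 0)%:R * f i = \sum_i f i.
Proof.
move=> f0; apply: eq_bigr => i _.
by case: eqVneq => [/f0 ->|_]; rewrite ?mulr0 ?mul1r.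
Qed.

Lemma rdot_cplx_self X :
  rdot (cplx X) (cplx X) = \sum_i gram_sqrt X i * gram_sqrt X i.
Proof.
have [U [P sX]] := svd_exists X.
rewrite (spectral_fun_id sX) (rdot_spectral_fun_same _ _ sX) sum_mask_neq0 //.
by move=> i /= ->; rewrite mulr0.
Qed.

(* The derivative of [r x + x ^+ 2] at [x > 0] is [2 * Num.max tau x]. *)
Lemma penalty_subgrad X Y U P : is_svd (cplx X) U (gram_sqrt X) P ->
  2 * rdot (spectral_fun U (gram_sqrt X) P (Num.max tau)) (cplx Y - cplx X) <=
  (penalty Y + frobenius Y ^+ 2) - (penalty X + frobenius X ^+ 2).
Proof.
have arith (a b r1 q1 r2 q2 : R) : 2 * a <= 2 * b - (r1 + q1) + (r2 + q2) ->
  2 * (a - b) <= r2 + q2 - (r1 + q1) by lra.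
move=> sX; have [V [Q sY]] := svd_exists Y.
have x0 i : 0 <= gram_sqrt X i by exact: sqrtr_ge0.
have y0 i : 0 <= gram_sqrt Y i by exact: sqrtr_ge0.
have max_ge0 i : 0 <= Num.max tau (gram_sqrt X i) by rewrite le_max tau_ge0.
(* [al i] is the convex conjugate of [r x + x ^+ 2] at the slope [2 * Num.max tau x], so the bound
   by [al i + be j] is the Fenchel-Young inequality. *)
pose al i := 2 * (Num.max tau (gram_sqrt X i) * gram_sqrt X i) -
  (r (gram_sqrt X i) + gram_sqrt X i * gram_sqrt X i).
pose be i := r (gram_sqrt Y i) + gram_sqrt Y i * gram_sqrt Y i.
have H : 2 * rdot (spectral_fun U (gram_sqrt X) P (Num.max tau)) (cplx Y) <=
    \sum_i al i + \sum_i be i.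
  rewrite (spectral_fun_id sY).
  apply: (@rdot_spectral_fun_le R m n _ _ _ _ _ _ _ _ (Num.max tau) id al be _ _ sX sY)
    => [|i|i|||i j]; [exact: ltr0n| | |exact: max_ge0|exact: y0|].
  (* Nonnegativity of [al] is the scalar inequality tested at 0. *)
  - have := r_fun_subgrad mu_gt0 (lexx 0) (x0 i).
    by rewrite r_fun0 // /al; lra.
  - by rewrite addr_ge0 ?r_fun_ge0 ?mulr_ge0.
  - have := r_fun_subgrad mu_gt0 (y0 j) (x0 i).
    by rewrite /al /be /=; lra.
have sameX : rdot (spectral_fun U (gram_sqrt X) P (Num.max tau)) (cplx X) =
    \sum_i Num.max tau (gram_sqrt X i) * gram_sqrt X i.
  rewrite (spectral_fun_id sX) (rdot_spectral_fun_same _ _ sX) sum_mask_neq0 //.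
  by move=> i /= ->; rewrite mulr0.
rewrite !frobenius_sq !rdot_cplx_self !penaltyE rdotDr rdotNr sameX.
have al_sum : \sum_i al i = 2 * (\sum_i Num.max tau (gram_sqrt X i) * gram_sqrt X i)
    - (\sum_i r (gram_sqrt X i) + \sum_i gram_sqrt X i * gram_sqrt X i).
  by rewrite mulr_sumr -big_split -sumrB.
have be_sum : \sum_i be i =
    \sum_i r (gram_sqrt Y i) + \sum_i gram_sqrt Y i * gram_sqrt Y i.
  by rewrite -big_split.
by apply: arith; rewrite -al_sum -be_sum; exact: H.
Qed.

Section Gap.
Variables (c : R) (X0 : 'M[F]_(m, n)).
Hypotheses (c_gt0 : 0 < c) (c_le1 : c <= 1).
Hypothesis gap : forall j, gram_sqrt X0 j = 0 \/ tau <= c * gram_sqrt X0 j.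

(** Once the square is expanded, only the cross term mixes the singular vectors of [X] and [X0]. The
    scalar input is [r_fun_growth], whose case [x = 0] also gives [0 <= be i]. *)
Lemma penalty_growth X :
  penalty X0 <= penalty X + c * frobenius (X - X0) ^+ 2.
Proof.
have arith (a q q0 p p0 : R) : 2 * c * a <= p + c * q + (c * q0 - p0) ->
  p0 <= p + c * (q + q0 - 2 * a) by lra.
have [U [P sX]] := svd_exists X; have [U0 [P0 sX0]] := svd_exists X0.
have x0 i : 0 <= gram_sqrt X i by exact: sqrtr_ge0.
have y0 i : 0 <= gram_sqrt X0 i by exact: sqrtr_ge0.
pose al i := r (gram_sqrt X i) + c * (gram_sqrt X i * gram_sqrt X i).
pose be i := c * (gram_sqrt X0 i * gram_sqrt X0 i) - r (gram_sqrt X0 i).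
have H : 2 * c * rdot (cplx X) (cplx X0) <= \sum_i al i + \sum_i be i.
  rewrite (spectral_fun_id sX) (spectral_fun_id sX0).
  apply: (@rdot_spectral_fun_le R m n _ _ _ _ _ _ _ _ id id al be _ _ sX sX0)
    => [|i|i|||i j]; [by rewrite mulr_gt0| | |exact: x0|exact: y0|].
  - by rewrite addr_ge0 ?r_fun_ge0 ?mulr_ge0 // ltW.
  - have := r_fun_growth mu_gt0 c_gt0 c_le1 (lexx 0) (gap i).
    by rewrite r_fun0 // /be; lra.
  - have := r_fun_growth mu_gt0 c_gt0 c_le1 (x0 i) (gap j).
    by rewrite /al /be /=; lra.
have al_sum : \sum_i al i = \sum_i r (gram_sqrt X i) +
    c * \sum_i gram_sqrt X i * gram_sqrt X i.
  by rewrite mulr_sumr -big_split.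
have be_sum : \sum_i be i = c * (\sum_i gram_sqrt X0 i * gram_sqrt X0 i) -
    \sum_i r (gram_sqrt X0 i).
  by rewrite mulr_sumr -sumrB.
rewrite !penaltyE frobenius_sq cplxB rdotB_self !rdot_cplx_self.
by apply: arith; rewrite -al_sum -be_sum; exact: H.
Qed.

Lemma subgrad_strongly_monotone X U P : is_svd (cplx X) U (gram_sqrt X) P ->
  (1 - c) * frobenius (X - X0) ^+ 2 <=
  rdot (spectral_fun U (gram_sqrt X) P (Num.max tau) - cplx X0) (cplx X - cplx X0).
Proof.
have arith (a b z q q0 : R) :
    1 * (b + (2 * c - 1) * a) <= z - (1 - c) * q + c * q0 ->
  (1 - c) * (q + q0 - 2 * a) <= z - b - (a - q0) by lra.
move=> sX; have [U0 [P0 sX0]] := svd_exists X0.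
have x0 i : 0 <= gram_sqrt X i by exact: sqrtr_ge0.
have y0 i : 0 <= gram_sqrt X0 i by exact: sqrtr_ge0.
have max_ge i : gram_sqrt X i <= Num.max tau (gram_sqrt X i) by rewrite le_max lexx orbT.
pose al i := Num.max tau (gram_sqrt X i) * gram_sqrt X i -
  (1 - c) * (gram_sqrt X i * gram_sqrt X i).
pose be i := c * (gram_sqrt X0 i * gram_sqrt X0 i).
(* [f] collects all cross terms with [X0]: one from Z, [-1 + 2 * (1 - c)] times the one from [X], up
   to sign. It is nonnegative on singular values because [f x >= 2 * c * x]. *)
pose f (x : R) := Num.max tau x + (2 * c - 1) * id x.
have H : 1 * rdot (spectral_fun U (gram_sqrt X) P f) (cplx X0) <=
    \sum_i al i + \sum_i be i.
  rewrite (spectral_fun_id sX0).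
  apply: (@rdot_spectral_fun_le R m n _ _ _ _ _ _ _ _ f id al be _ _ sX sX0)
    => [|i|i|i||i j]; [exact: ltr01| | | |exact: y0|].
  - rewrite /al subr_ge0 mulrA ler_wpM2r //; apply: le_trans (max_ge i).
    by rewrite ler_piMl // gerBl ltW.
  - by rewrite !mulr_ge0 // ltW.
  - by have := max_ge i; have := mulr_ge0 (ltW c_gt0) (x0 i); rewrite /f /=; lra.
  - have := subgrad_monotone mu_gt0 c_gt0 c_le1 (x0 i) (gap j).
    by rewrite /al /be /f /=; lra.
have sameX : rdot (spectral_fun U (gram_sqrt X) P (Num.max tau)) (cplx X) =
    \sum_i Num.max tau (gram_sqrt X i) * gram_sqrt X i.
  rewrite (spectral_fun_id sX) (rdot_spectral_fun_same _ _ sX) sum_mask_neq0 //.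
  by move=> i /= ->; rewrite mulr0.
rewrite /f spectral_fun_addZ -(spectral_fun_id sX) rdotDl rdotZl in H.
have al_sum : \sum_i al i = \sum_i Num.max tau (gram_sqrt X i) * gram_sqrt X i -
    (1 - c) * \sum_i gram_sqrt X i * gram_sqrt X i.
  by rewrite mulr_sumr -sumrB.
have be_sum : \sum_i be i = c * \sum_i gram_sqrt X0 i * gram_sqrt X0 i.
  by rewrite mulr_sumr.
rewrite frobenius_sq cplxB rdotB_self rdotBB sameX !rdot_cplx_self.
by apply: arith; rewrite -al_sum -be_sum; exact: H.
Qed.

(* Both inequalities on subgradients are used at the moved point and not at X, so
   that no limit of subgradients is needed. *)
Lemma penalty_segment X t : 0 < t < 1 ->
  penalty (X + of_real s t *: (X0 - X)) <=
  penalty X + t * (2 * c + t * (1 - 2 * c)) * frobenius (X0 - X) ^+ 2.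
Proof.
move=> /andP[t0 t1]; set D := X0 - X; set Y := X + _.
have [U [P sY]] := svd_exists Y.
have := subgrad_strongly_monotone sY; have := penalty_subgrad X sY.
set Z := spectral_fun _ _ _ _.
have cD : cplx X0 = cplx X + cplx D by rewrite -cplxD /D addrC subrK.
have cY : cplx Y = cplx X + t%:C%C *: cplx D by rewrite cplxD cplxZ.
rewrite !frobenius_sq cplxB cY cD !rdotE (rdotC (cplx D) (cplx X)).
move: (rdot (cplx X) (cplx X)) (rdot (cplx X) (cplx D)) (rdot (cplx D) (cplx D))
  (rdot Z (cplx X)) (rdot Z (cplx D)) (penalty X) (penalty Y) =>
  xx xd dd zx zd p p' pen mono.
(* Since [Y - X0] is [-(1 - t)] times [D], monotonicity at [Y] can be divided by [1 - t]. It bounds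
   the inner product of [Z] and [D], which the subgradient inequality from [Y] to [X] carries with
   factor [2 * t]. *)
have zd_le : zd <= (xx - xx + xd) + dd - (1 - c) * (1 - t) * dd.
  rewrite -(ler_pM2l (x := 1 - t)) ?subr_gt0 //.
  by clear pen; lra.
have : t * zd <= t * ((xx - xx + xd) + dd - (1 - c) * (1 - t) * dd).
  by rewrite ler_wpM2l // ltW.
lra.
Qed.

End Gap.
End Comparison.

(** * Frobenius norm, neighbourhoods and stationarity *)

Section FrobeniusTopology.
Variables (R : realType) (s : scalars) (m n : nat).
Local Notation F := (field_of R s).
Local Notation of_real := (@of_real R s).
Local Notation normc := (@ComplexField.Normc.normc R).
Implicit Types X Y D : 'M[F]_(m, n).

Lemma normc_ge0 (z : R[i]) : 0 <= normc z.
Proof. by case: z => a b; exact: sqrtr_ge0. Qed.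

Lemma normc_of_real a : normc (to_complex (of_real a)) = `|a|.
Proof. by rewrite to_complex_of_real /= expr0n addr0 sqrtr_sqr. Qed.

Lemma normc_le_frobenius X i j : normc (to_complex (X i j)) <= frobenius X.
Proof.
rewrite -(ger0_norm (normc_ge0 _)) -sqrtr_sqr ler_wsqrtr //.
rewrite (bigD1 i) //= (bigD1 j) //= -addrA lerDl addr_ge0 //.
  by apply: sumr_ge0 => *; exact: sqr_ge0.
by do 2![apply: sumr_ge0 => *]; exact: sqr_ge0.
Qed.

Lemma frobeniusZ a X : 0 <= a -> frobenius (of_real a *: X) = a * frobenius X.
Proof.
move=> a0; apply/eqP; rewrite -(@eqrXn2 _ 2) ?mulr_ge0 ?frobenius_ge0 //.
by rewrite exprMn !frobenius_sq cplxZ !rdotE mulrA.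
Qed.

Lemma frobenius_sym X Y : frobenius (X - Y) = frobenius (Y - X).
Proof.
apply/eqP; rewrite -(@eqrXn2 _ 2) ?frobenius_ge0 //.
by rewrite !frobenius_sq !cplxB !rdotB_self (rdotC (cplx Y))
  [rdot (cplx X) (cplx X) + _]addrC.
Qed.

Lemma near_frobenius X (e : R) : 0 < e -> \forall Y \near X, frobenius (Y - X) <= e.
Proof.
move=> e0; pose M := (m * n)%:R : R; have M0 : 0 <= M by exact: ler0n.
(* [M + 1] keeps the denominator positive for empty matrices, and [M <= (M + 1) ^+ 2] suffices. *)
pose d := e / (M + 1); have d0 : 0 < d by rewrite divr_gt0 // ltr_wpDl.
apply/nbhs_ballP; exists (of_real d) => [|Y [_ XY]] /=.
  have -> : 0 = of_real 0 by rewrite /of_real; case: (s).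
  by rewrite ltr_of_real.
have sq_le : frobenius (Y - X) ^+ 2 <= M * d ^+ 2.
  rewrite sqr_sqrtr; last by do 2![apply: sumr_ge0 => ? _]; exact: sqr_ge0.
  apply: (@le_trans _ _ (\sum_(i < m) \sum_(j < n) d ^+ 2)).
    apply: ler_sum => i _; apply: ler_sum => j _.
    rewrite ler_pXn2r ?nnegrE ?normc_ge0 ?(ltW d0) //.
    apply: ltW; move: (XY i j); rewrite /ball /= -normrN opprB norm_of_real ltr_of_real.
    by rewrite !mxE.
  by rewrite !sumr_const !card_ord -!mulrnA mulr_natl mulnC.
rewrite -(ler_pXn2r (n := 2)) ?nnegrE ?frobenius_ge0 ?(ltW e0) //.
apply: le_trans sq_le _; rewrite /d expr_div_n mulrA ler_pdivrMr ?exprn_gt0 ?ltr_wpDl //.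
rewrite mulrC ler_wpM2l ?sqr_ge0 //; nra.
Qed.

Lemma nbhs_segment X D (V : set 'M[F]_(m, n)) : nbhs X V ->
  exists2 t0, 0 < t0 & forall t, 0 < t < t0 -> V (X + of_real t *: D).
Proof.
move=> /nbhs_ballP [e /of_real_gt0 [r r0 ->] XV].
have f0 : 0 < frobenius D + 1 by rewrite ltr_wpDl ?frobenius_ge0.
exists (r / (frobenius D + 1)) => [|t /andP[t0 tr]]; first by rewrite divr_gt0.
apply: XV; split=> [|i j].
  have -> : 0 = of_real 0 by rewrite /of_real; case: (s).
  by rewrite ltr_of_real.
rewrite /ball /= -normrN opprB norm_of_real ltr_of_real.
rewrite !mxE [X i j + _]addrC addrK rmorphM ComplexField.Normc.normcM normc_of_real.
rewrite gtr0_norm //; apply: (@le_lt_trans _ _ (t * (frobenius D + 1))).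
  by rewrite ler_wpM2l ?(ltW t0) // ler_wpDr ?normc_le_frobenius.
by rewrite -ltr_pdivlMr.
Qed.

(** The difference quotient is at least [- k * frobenius (Y - X)], hence at least [- e] within
    distance [e / k]. *)
Lemma stationary_of_quadratic_growth (g : 'M[F]_(m, n) -> R) X k : 0 < k ->
  (forall Y, g X <= g Y + k * frobenius (Y - X) ^+ 2) -> stationary g X.
Proof.
move=> k0 gX; rewrite /stationary limf_einfE; apply/lee_addgt0Pr => e e0.
rewrite -leeBlDr //.
pose V := [set Y | Y != X /\ frobenius (Y - X) <= e / k].
apply: (@le_trans _ _ (ereal_inf [set ((g Y - g X) / frobenius (Y - X))%:E | Y in V])).
  apply: le_ereal_inf_tmp => _ [Y [YX Yk] <-].
  have f0 : 0 < frobenius (Y - X).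
    rewrite lt_neqAle frobenius_ge0 andbT eq_sym; apply: contra YX => /eqP.
    by move/frobenius_eq0/eqP; rewrite subr_eq0.
  rewrite sub0e lee_fin ler_pdivlMr //.
  have := gX Y; rewrite ler_pdivlMr // in Yk.
  have : frobenius (Y - X) * (frobenius (Y - X) * k) <= frobenius (Y - X) * e.
    by rewrite ler_wpM2l // ltW.
  by rewrite expr2; lra.
apply: ereal_sup_ubound; exists V => //.
by apply: filterS (near_frobenius X (divr_gt0 e0 k0)) => Y Yk YX; split.
Qed.

(** Every punctured neighbourhood contains points of the ray where the quotient is at most
    [- (k / frobenius D)], so the lower limit is negative. *)
Lemma not_stationary_of_descent (g : 'M[F]_(m, n) -> R) X D k t1 : D != 0 ->
  0 < k -> 0 < t1 ->
  (forall t, 0 < t < t1 -> g (X + of_real t *: D) <= g X - k * t) ->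
  ~ stationary g X.
Proof.
move=> D0 k0 t10 gX; have fD0 : 0 < frobenius D.
  rewrite lt_neqAle frobenius_ge0 andbT eq_sym; apply: contra D0 => /eqP.
  by move/frobenius_eq0/eqP.
rewrite /stationary limf_einfE => ge0.
suff : (0%:E <= (- (k / frobenius D))%:E)%E.
  by rewrite lee_fin oppr_ge0 leNgt divr_gt0.
apply: le_trans ge0 _; apply: ge_ereal_sup => _ [V /= XV <-].
have [t0 t00 tV] := nbhs_segment D XV.
pose t := Num.min t0 t1 / 2.
have tpos : 0 < t by rewrite divr_gt0 // lt_min t00.
have min0 : 0 < Num.min t0 t1 by rewrite lt_min t00.
have tmin : t < Num.min t0 t1 by rewrite /t; lra.
have [tt0 tt1] : t < t0 /\ t < t1 by move: tmin; rewrite lt_min => /andP.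
pose Y := X + of_real t *: D.
have YX : Y - X = of_real t *: D by rewrite /Y addrC addKr.
apply: (@le_trans _ _ ((g Y - g X) / frobenius (Y - X))%:E).
  apply: ereal_inf_lbound; exists Y => //; apply: tV; first by rewrite tpos.
  rewrite -subr_eq0 YX; apply: contraTneq fD0 => tD0.
  have := frobeniusZ D (ltW tpos); rewrite tD0.
  have -> : frobenius (0 : 'M[F]_(m, n)) = 0.
    by have := @frobeniusZ 0 0 (lexx _); rewrite mul0r scaler0.
  by move/esym/eqP; rewrite mulf_eq0 gt_eqF //= => /eqP ->; rewrite ltxx.
rewrite lee_fin YX frobeniusZ ?(ltW tpos) // ler_pdivrMr ?mulr_gt0 //.
have gY : g Y <= g X - k * t by apply: gX; rewrite tpos.
by rewrite mulNr mulrCA divfK ?gt_eqF // mulrC lerBlDl.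
Qed.

End FrobeniusTopology.

(** * Restricted isometry and the theorem *)

Lemma lower_ricP (R : realType) (s : scalars) n1 n2 m
    (A : {linear 'M[field_of R s]_(n1, n2) -> 'cV[field_of R s]_m}) J X :
  (\rank X <= J)%N ->
  (1 - lower_ric A J) * frobenius X ^+ 2 <= frobenius (A X) ^+ 2.
Proof.
move=> XJ; rewrite /lower_ric opprB addrCA subrr addr0; set E := [set q | _].
(* Zero does not enter the infimum, so it is treated apart. *)
have [->|X0] := eqVneq X 0.
  rewrite !frobenius_sq /cplx map_mx0 -[X in rdot X X](scale0r (0 : 'M[R[i]]_(n1,n2))).
  by rewrite -[0 in X in X <= _]/(0%:C)%C !rdotE mul0r mulr0 rdot_ge0.
have fX0 : 0 < frobenius X ^+ 2.
  rewrite exprn_gt0 // lt_neqAle frobenius_ge0 andbT eq_sym.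
  by apply: contra X0 => /eqP/frobenius_eq0/eqP.
rewrite -ler_pdivlMr //; apply: ge_inf; last by exists X.
by exists 0 => _ [Y [_ _ ->]]; rewrite divr_ge0 ?sqr_ge0.
Qed.

Theorem theorem1p2 (R : realType) (s : scalars) (n1 n2 m : nat) (mu : R)
    (A : {linear 'M[field_of R s]_(n1, n2) -> 'cV[field_of R s]_m}) (K : nat)
    (X0 : 'M[field_of R s]_(n1, n2)) (b : 'cV[field_of R s]_m)
    (mu_gt0 : 0 < mu) (K_ge1 : (1 <= K)%N)
    (bE : b = A X0) (rank_X0 : \rank X0 = K)
    (delta_bounds : 0 < lower_ric A (2 * K) < 1)
    (sigma_gt : Num.sqrt mu / (1 - lower_ric A (2 * K)) < sigma K X0) :
  [/\ stationary (R_reg mu A b) X0,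
      [set X0] = argmin [set X | (\rank X <= K)%N] (R_reg mu A b)
    & forall X, stationary (R_reg mu A b) X -> X <> X0 -> (K < \rank X)%N].
Proof.
set q := 1 - lower_ric A (2 * K) in sigma_gt.
have [q0 q1] : 0 < q /\ q < 1 by move: delta_bounds => /andP[]; rewrite /q; lra.
set tau := Num.sqrt mu in sigma_gt; have tau0 : 0 < tau by rewrite sqrtr_gt0.
have sig0 : 0 < sigma K X0 by apply: lt_trans sigma_gt; rewrite divr_gt0.
pose c := tau / sigma K X0.
have c0 : 0 < c by rewrite divr_gt0.
have cq : c < q by rewrite ltr_pdivrMr // -ltr_pdivrMl // mulrC.
have c1 : c <= 1 by rewrite ltW // (lt_trans cq).
have gap j : gram_sqrt X0 j = 0 \/ tau <= c * gram_sqrt X0 j.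
  have [->|sj] := gram_sqrt_gap j (eq_leq rank_X0); [by left|right].
  by rewrite /c mulrAC ler_pdivlMr // ler_wpM2l // ltW.
have RE X : R_reg mu A b X = penalty mu X + frobenius (A (X - X0)) ^+ 2.
  by rewrite bE linearB.
have RX0 : R_reg mu A b X0 = penalty mu X0.
  by rewrite RE subrr linear0 frobenius_sq /cplx map_mx0 -(subrr 0) rdotB_self; ring.
(* [X - X0] has rank at most [K + K], whence the constant of order [2 * K]. *)
have ric X : (\rank X <= K)%N ->
    q * frobenius (X - X0) ^+ 2 <= frobenius (A (X - X0)) ^+ 2.
  move=> XK; apply: lower_ricP; apply: leq_trans (mxrank_add _ _) _.
  by rewrite mxrank_opp rank_X0 mul2n -addnn leq_add2r.
have growth := penalty_growth mu_gt0 c0 c1 gap.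
have frob_gt0 X : X <> X0 -> 0 < frobenius (X - X0) ^+ 2.
  move=> XX0; rewrite exprn_gt0 // lt_neqAle frobenius_ge0 andbT eq_sym.
  by apply/eqP => /frobenius_eq0/eqP; rewrite subr_eq0 => /eqP.
split.
- apply: (stationary_of_quadratic_growth c0) => Y; rewrite RX0 RE.
  have := growth Y; have := sqr_ge0 (frobenius (A (Y - X0))).
  move: (frobenius _ ^+ 2) (frobenius (A _) ^+ 2) (penalty mu X0) (penalty mu Y).
  by clear; move=> *; lra.
(* The data term gains at least [q] times the squared distance and the penalty loses at most [c]
   times it, with [c < q]. *)
- have strict X : (\rank X <= K)%N -> X <> X0 -> R_reg mu A b X0 < R_reg mu A b X.
    move=> XK /frob_gt0; rewrite RX0 RE.
    move: (growth X) (ric X XK).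
    move: (frobenius (X - X0) ^+ 2) (frobenius (A _) ^+ 2) (penalty mu X0) (penalty mu X).
    move=> u v p0 p gr ri u0; have : 0 < (q - c) * u by rewrite mulr_gt0 // subr_gt0.
    by clear -gr ri; lra.
  apply/seteqP; split=> X /=.
    move=> ->; split=> [|Y YK]; first exact: eq_leq rank_X0.
    by have [->//|/eqP YX0] := eqVneq Y X0; rewrite ltW // strict.
  move=> [XK Xmin]; apply: contrapT => XX0.
  have := Xmin X0 (eq_leq rank_X0); rewrite leNgt; apply/negP/negPn.
  exact: strict.
- move=> X Xstat XX0; rewrite ltnNge; apply/negP => XK; move: Xstat.
  pose D := X0 - X; have fD := frobenius_sym X X0.
  pose k := (q - c) * frobenius D ^+ 2.
  have fD0 : 0 < frobenius D ^+ 2 by rewrite -fD frob_gt0.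
  (* With [d] the squared norm of [D], the functional changes by at most [t * d * (t * (1 - 2 * c +
     q) - 2 * (q - c))]. As [1 - 2 * c + q < 2], for [t < t1] this is at most [- k * t]. *)
  pose t1 := (q - c) / 2.
  apply: (@not_stationary_of_descent _ _ _ _ _ X D k t1).
  + by rewrite subr_eq0 eq_sym; apply/eqP.
  + by rewrite mulr_gt0 // subr_gt0.
  + by rewrite divr_gt0 // subr_gt0.
  + move=> t /andP[t0 tt1]; have tl1 : t < 1 by move: tt1; rewrite /t1; clear -q1 c0; lra.
    have t01 : 0 < t < 1 by rewrite t0.
    have := penalty_segment mu_gt0 c0 c1 gap X t01; rewrite -/D.
    have := ric X XK; rewrite fD -/D.
    rewrite !RE.
    (* Along the segment the residual is scaled by [1 - t], so the data term drops by
       [2 * t - t * t] times its value at [X]. *)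
    have -> : X + of_real s t *: D - X0 = of_real s (1 - t) *: (X - X0).
      have -> : of_real s (1 - t) = 1 - of_real s t.
        apply: (fmorph_inj (@to_complex R s)); rewrite /= to_complex_of_real.
        by rewrite !rmorphB !rmorph1 /= to_complex_of_real.
      by rewrite scalerBl scale1r /D -[X0 - X]opprB scalerN addrAC.
    have t1_ge0 : 0 <= 1 - t by rewrite subr_ge0 ltW.
    rewrite [A (_ *: _)]linearZ /= (frobeniusZ (A (X - X0)) t1_ge0) exprMn.
    rewrite /k; move: (penalty _ _) (penalty _ _) => p' p.
    move: (frobenius D ^+ 2) (frobenius (A _) ^+ 2) fD0 => d a d0 qa pen.
    have : (2 * t - t * t) * (q * d) <= (2 * t - t * t) * a.
      by apply: ler_wpM2l => //; clear -t0 tl1; nra.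
    have : t * d * (t * (1 - 2 * c + q)) <= t * d * (q - c).
      apply: ler_wpM2l; first by rewrite mulr_ge0 // ltW.
      by move: tt1; rewrite /t1; clear -t0 q1 q0 c0; nra.
    by clear -pen; lra.
Qed.
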